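(* If $n\ge 3$, then the inequalities $$C_1\le \frac{A_n-H_n}{Q_n-H_n}\le C_2$$ hold true for all nonnegative real numbers $x_1,\ldots,x_n$ if and only if $C_1\le\frac{1}{\sqrt{n}}$ and $C_2\ge\sqrt{\frac{n-1}{n}}$. Equality in the left inequality holds if and only if $C_1=\frac{1}{\sqrt{n}}$, and all $x_i$ are equal to zero except one. Equality in the right inequality holds if and only if $C_2=\sqrt{\frac{n-1}{n}}$, and all $x_i$ are equal to each other except one which is zero.
   Context: Here $n$ is an integer and $C_1,C_2$ are real constants. For nonnegative real numbers $x_1,\ldots,x_n$, the harmonic, arithmetic and quadratic means are $$H_n=\frac{n}{\sum_{i=1}^n \frac{1}{x_i}},\qquad A_n=\frac{1}{n}\sum_{i=1}^n x_i,\qquad Q_n=\sqrt{\frac{1}{n}\sum_{i=1}^n x_i^2},$$ with the convention that $H_n=0$ if $x_i=0$ for some $i$. At points $x_1=\cdots=x_n=x>0$, where the ratio $\frac{A_n-H_n}{Q_n-H_n}$ has the form $0/0$, it is extended continuously and given the value $\frac{2}{3}$, which is its limit as $(x_1,\ldots,x_n)\to(x,\ldots,x)$. *)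

(* Defs.v *)
From mathcomp Require Import all_boot all_order all_algebra.
From mathcomp Require Import reals.

Set Implicit Arguments.
Unset Strict Implicit.
Unset Printing Implicit Defensive.

Import Order.TTheory GRing.Theory Num.Theory.
Local Open Scope ring_scope.

(* The case split is needed because 0^-1 = 0 in MathComp: without it, zero
   entries would merely be dropped from the sum of reciprocals. *)
Definition harmonic_mean (R : realType) (n : nat) (x : 'I_n -> R) : R :=
  if [exists i, x i == 0] then 0 else n%:R / \sum_(i < n) (x i)^-1.

Definition arithmetic_mean (R : realType) (n : nat) (x : 'I_n -> R) : R :=
  n%:R^-1 * \sum_(i < n) x i.

Definition quadratic_mean (R : realType) (n : nat) (x : 'I_n -> R) : R :=
  Num.sqrt (n%:R^-1 * \sum_(i < n) x i ^+ 2).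

(* The quotient is 0/0 on the diagonal; at (c, ..., c) with c > 0 the value is
   its limit 2/3. No limit exists at the origin, so the value there is
   meaningless and the origin is excluded by mean_domain. *)
Definition mean_ratio (R : realType) (n : nat) (x : 'I_n -> R) : R :=
  if [forall i, forall j, x i == x j] then 2 / 3
  else (arithmetic_mean x - harmonic_mean x)
         / (quadratic_mean x - harmonic_mean x).

Definition mean_domain (R : realType) (n : nat) (x : 'I_n -> R) : Prop :=
  (forall i, 0 <= x i) /\ (exists i, x i != 0).

(* Main.v *)
Require Import Defs.
From mathcomp Require Import all_boot all_order all_algebra.
From mathcomp Require Import reals.
From mathcomp Require Import ring lra.

Set Implicit Arguments.
Unset Strict Implicit.
Unset Printing Implicit Defensive.

Import Order.TTheory GRing.Theory Num.Theory.
Local Open Scope ring_scope.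

(** Write A, Q and H for the three means of x, r for the square root of n and p
    for that of n - 1. For a nonconstant vector H < Q, so the two bounds
    1 / r and p / r on the ratio read
      (r - 1) H <= r A - Q     and     r A - p Q <= (r - p) H.

    If some entry vanishes then H = 0, and the claims are comparisons of A with
    Q. The lower one says that the sum of the squares is at most the square of
    the sum, with equality when every entry is 0 or the whole sum
    ([leif_lower_bound_zero]); the upper one is the Cauchy-Schwarz inequality for the
    n - 1 entries other than the zero, with equality when those entries agree
    ([leif_upper_bound_zero]). These are the two equality cases of the theorem.

    If all entries are positive, both inequalities are strict. Keep A and Q
    fixed and let H vary: the extreme values of H should occur at vectors of the
    form (a, ..., a, b). Given x, two such vectors have the same A and Q as x,
    one with a < b and one with b < a, and all entries of x lie between the
    values b of these two vectors ([extreme_entry]). So (x_i - a)^2 (b - x_i)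
    has the sign of b - a for every i. Dividing by x_i and summing turns
    this into a comparison of the sum of the 1 / x_i with its value at
    (a, ..., a, b), because the remaining terms depend only on A and Q
    ([inv_sum_compare]). This gives an upper bound on H when a < b, and a lower
    bound when b < a, and leaves inequalities in the two numbers a and b. After
    squaring away the root, the difference of the two sides has the factor
    (a - b)^2, since both are equalities at a = b, and the cofactor is positive
    as soon as n >= 3 ([two_value_lower], [two_value_upper]).

    For the upper bound the vector (a, ..., a, b) may have b <= 0; the entries
    are then so spread out that r A <= p Q, which suffices because H > 0.

    On the diagonal the value 2 / 3 lies strictly between the two bounds when
    n >= 3. *)

(** * Vectors with two distinct values *)

Section TwoValues.
Variable R : rcfType.

(** This is (r - 1) H < r A - Q, multiplied by r, at the vector (a, ..., a, b) of
    length n = r ^ 2. With D the denominator and q the root, it is q D < P; here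
    P^2 - q^2 D^2 is cubic in b and vanishes doubly at b = a, and the remaining
    linear factor is positive because r^2 - r - 1 > 0, which fails for n = 2. *)
Lemma two_value_lower (r a b : R) : 3 <= r ^+ 2 -> 0 < r -> 0 < a -> a < b ->
  (r ^+ 2 - r) * (r ^+ 2 * (a * b) / ((r ^+ 2 - 1) * b + a)) <
  (r ^+ 2 - 1) * a + b - Num.sqrt ((r ^+ 2 - 1) * a ^+ 2 + b ^+ 2).
Proof.
move=> r3 r0 a0 ab.
have b0 : 0 < b by lra.
set q := Num.sqrt _.
have q0 : 0 <= q by exact: sqrtr_ge0.
have q2 : q ^+ 2 = (r ^+ 2 - 1) * a ^+ 2 + b ^+ 2.
  by rewrite sqr_sqrtr // addr_ge0 ?sqr_ge0 // mulr_ge0 ?sqr_ge0 //; lra.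
have r32 : 3 / 2 < r by rewrite ltNge; apply/negP => h; nra.
set D := (r ^+ 2 - 1) * b + a.
have D0 : 0 < D by rewrite addr_gt0 // mulr_gt0 //; lra.
have ab0 : 0 < a * b by rewrite mulr_gt0.
pose P := ((r ^+ 2 - 1) * a + b) * D - (r ^+ 2 - r) * (r ^+ 2 * (a * b)).
have P0 : 0 < P.
  have -> : P = (r ^+ 2 - 1) * (b - a) ^+ 2 + r ^+ 3 * (a * b).
    by rewrite /P /D; ring.
  by rewrite ltr_wpDl ?mulr_ge0 ?sqr_ge0 ?mulr_gt0 ?exprn_gt0 //; lra.
suff : q * D < P by rewrite /P => h; rewrite mulrA ltr_pdivrMr //; lra.
rewrite -(@ltr_pXn2r _ 2) ?nnegrE ?mulr_ge0 ?(ltW D0) ?(ltW P0) //.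
rewrite exprMn q2 -subr_gt0.
have -> : P ^+ 2 - ((r ^+ 2 - 1) * a ^+ 2 + b ^+ 2) * D ^+ 2 =
  a * (b - a) ^+ 2 * ((r ^+ 2 - 1) *
    (2 * (r - 1) * (r ^+ 2 - r - 1) * b + (r ^+ 2 - 2) * a)).
  by rewrite /P /D; ring.
have h1 : 0 < r ^+ 2 - r - 1.
  by case: (ltP r 2) => h; nra.
rewrite !mulr_gt0 ?exprn_gt0 ?subr_gt0 //; first lra.
by rewrite addr_gt0 ?mulr_gt0 //; lra.
Qed.

(** This is r A - p Q < (r - p) H, multiplied by r, at the vector (a, ..., a, b) of
    length n = r ^ 2. The difference of the squares vanishes at b = 0, which is
    the equality case of the theorem, and doubly at b = a; hence the factors b
    and (a - b)^2 below. *)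
Lemma two_value_upper (r p a b : R) : 3 <= r ^+ 2 -> 0 < r -> 0 < p ->
  p ^+ 2 = r ^+ 2 - 1 -> 0 < b -> b < a ->
  (r ^+ 2 - 1) * a + b - p * Num.sqrt ((r ^+ 2 - 1) * a ^+ 2 + b ^+ 2) <
  (r ^+ 2 - r * p) * (r ^+ 2 * (a * b) / ((r ^+ 2 - 1) * b + a)).
Proof.
move=> r3 r0 p0 pE b0 ba.
have a0 : 0 < a by lra.
set q := Num.sqrt _.
have q0 : 0 <= q by exact: sqrtr_ge0.
have q2 : q ^+ 2 = (r ^+ 2 - 1) * a ^+ 2 + b ^+ 2.
  by rewrite sqr_sqrtr // addr_ge0 ?sqr_ge0 // mulr_ge0 ?sqr_ge0 //; lra.
set D := (r ^+ 2 - 1) * b + a.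
have D0 : 0 < D by rewrite addr_gt0 // mulr_gt0 //; lra.
pose m := r ^+ 2 - 1.
pose K := r ^+ 2 * (r ^+ 2 - r * p).
(* Through this relation p enters the factorisation below only via K. *)
have KE : (r ^+ 2 * r ^+ 2 - K) ^+ 2 = (r ^+ 2) ^+ 3 * m.
  have -> : r ^+ 2 * r ^+ 2 - K = r ^+ 3 * p by rewrite /K; ring.
  by rewrite exprMn pE /m; ring.
pose P := ((r ^+ 2 - 1) * a + b) * D - K * (a * b).
suff : P < p * q * D.
  rewrite /P /K => h; rewrite mulrA ltr_pdivlMr //; lra.
have pqD : 0 <= p * q * D by rewrite !mulr_ge0 // ltW.
case: (ltP P 0) => [|P0]; first by move=> /lt_le_trans; apply.
rewrite -(@ltr_pXn2r _ 2) ?nnegrE // !exprMn q2 pE -subr_gt0.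
have -> : (r ^+ 2 - 1) * ((r ^+ 2 - 1) * a ^+ 2 + b ^+ 2) * D ^+ 2 - P ^+ 2 =
  b * (a - b) ^+ 2 * (m * (m * (m - 1) * b + 2 * (K - 1) * a))
  - (a * b) ^+ 2 * ((r ^+ 2 * r ^+ 2 - K) ^+ 2 - (r ^+ 2) ^+ 3 * m).
  by rewrite /P /D /m; ring.
rewrite KE subrr mulr0 subr0.
(* As r^2 - p^2 = 1, the square (r - p)^2 > 0 says r p < r^2 - 1/2. *)
have K1 : 1 < K.
  have : 0 < (r - p) ^+ 2.
    rewrite lt0r sqr_ge0 andbT sqrf_eq0 subr_eq0; apply/eqP => rp.
    by move: pE; rewrite rp; lra.
  have h : r ^+ 2 - r * p > 1 / 2 by nra.
  by rewrite /K; nra.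
rewrite !mulr_gt0 ?exprn_gt0 ?subr_gt0 //; first by rewrite /m; lra.
by rewrite addr_gt0 ?mulr_gt0 /m //; lra.
Qed.
End TwoValues.

(** * The sum of the reciprocals at fixed sum and sum of squares *)

Lemma sum_sqr_dev (R : comNzRingType) (I : finType) (P : pred I) (f : I -> R) (c : R) :
  \sum_(i | P i) (f i - c) ^+ 2 =
  \sum_(i | P i) f i ^+ 2 - 2 * c * (\sum_(i | P i) f i) + #|P|%:R * c ^+ 2.
Proof.
have -> : #|P|%:R * c ^+ 2 = \sum_(i | P i) c ^+ 2.
  by rewrite mulr_natl -sumr_const; apply: eq_bigl.
rewrite mulr_sumr -sumrB -big_split /=.
by apply: eq_bigr => i _; ring.
Qed.

Section Sums.
Variables (R : realFieldType) (n : nat).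
Hypothesis n2 : (2 <= n)%N.
Implicit Type x : 'I_n -> R.
Local Notation N := (n%:R : R).

Lemma card_others (j : 'I_n) : #|[pred i | i != j]|%:R = N - 1.
Proof. by rewrite cardC1 card_ord -subn1 natrB // ltnW. Qed.

(** The difference is the spread of the other entries around their own mean. Its
    sign confines each entry once the two sums are fixed; for x j = 0 it is the
    Cauchy-Schwarz inequality for the n - 1 other entries. *)
Lemma spread_others x (j : 'I_n) :
  (N - 1) * (\sum_i x i ^+ 2 - x j ^+ 2) - (\sum_i x i - x j) ^+ 2 =
  (N - 1) * \sum_(i | i != j) (x i - (\sum_i x i - x j) / (N - 1)) ^+ 2.
Proof.
have m0 : N - 1 != 0 :> R by rewrite subr_eq0 pnatr_eq1 gtn_eqF.
rewrite sum_sqr_dev card_others.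
have -> : \sum_i x i = x j + \sum_(i | i != j) x i by rewrite (bigD1 j).
have -> : \sum_i x i ^+ 2 = x j ^+ 2 + \sum_(i | i != j) x i ^+ 2.
  by rewrite (bigD1 j).
by field.
Qed.

Lemma spread_gt0 x (A : R) : \sum_i x i = N * A ->
  ~~ [forall i, forall j, x i == x j] -> N * A ^+ 2 < \sum_i x i ^+ 2.
Proof.
move=> SE nc; rewrite -subr_gt0.
have -> : \sum_i x i ^+ 2 - N * A ^+ 2 = \sum_i (x i - A) ^+ 2.
  by rewrite sum_sqr_dev SE cardT size_enum_ord; ring.
rewrite lt0r sumr_ge0 ?andbT; last by move=> i _; exact: sqr_ge0.
apply: contra nc => /eqP /psumr_eq0P h.
have xA i : x i = A.
  by apply/eqP; rewrite -subr_eq0 -sqrf_eq0 h // => k _; exact: sqr_ge0.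
by apply/forallP => i; apply/forallP => j; rewrite !xA.
Qed.

(** Cauchy-Schwarz for the entries other than x j is a quadratic inequality in x j
    whose roots are b and a second number on the same side of b as a. The product
    form covers both orders of a and b. *)
Lemma extreme_entry x (a b : R) (j : 'I_n) :
  \sum_i x i = (N - 1) * a + b -> \sum_i x i ^+ 2 = (N - 1) * a ^+ 2 + b ^+ 2 ->
  0 <= (b - a) * (b - x j).
Proof.
move=> S1 S2.
have N2 : 2 <= N by rewrite ler_nat.
have h : 0 <= (N - 1) * (\sum_i x i ^+ 2 - x j ^+ 2) - (\sum_i x i - x j) ^+ 2.
  by rewrite spread_others mulr_ge0 ?sumr_ge0 //; [lra|move=> i _; exact: sqr_ge0].
rewrite S1 S2 in h.
have {}h : N * (b - x j) ^+ 2 <= 2 * (N - 1) * ((b - a) * (b - x j)).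
  by rewrite -subr_ge0; move: h; congr (_ <= _); ring.
have h2 : 0 <= N * (b - x j) ^+ 2 by rewrite mulr_ge0 ?sqr_ge0 //; lra.
by have := le_trans h2 h; rewrite pmulr_rge0 //; lra.
Qed.

(** The sum of the reciprocals is compared with (n - 1) / a + 1 / b, its value at
    (a, ..., a, b), with denominators cleared so that b may have any sign. The
    cubic (t - a)^2 (b - t) vanishes at both values of that vector and has a
    constant sign on the range that [extreme_entry] allows for the entries. *)
Lemma inv_sum_compare x (a b : R) : (forall i, 0 < x i) -> 0 < a ->
  \sum_i x i = (N - 1) * a + b -> \sum_i x i ^+ 2 = (N - 1) * a ^+ 2 + b ^+ 2 ->
  0 <= (b - a) * (a * b * \sum_i (x i)^-1 - ((N - 1) * b + a)).
Proof.
move=> x0 a0 S1 S2.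
have h : 0 <= \sum_i (b - a) * ((x i - a) ^+ 2 * (b - x i) / x i).
  apply: sumr_ge0 => i _.
  rewrite mulrA mulrCA mulr_ge0 ?invr_ge0 ?(ltW (x0 i)) //.
  by rewrite mulr_ge0 ?sqr_ge0 // extreme_entry.
rewrite -mulr_sumr in h.
have E : \sum_i ((x i - a) ^+ 2 * (b - x i) / x i) =
  a * (a * b * \sum_i (x i)^-1 - ((N - 1) * b + a)).
  transitivity (- \sum_i x i ^+ 2 + (b + 2 * a) * \sum_i x i
     - N * (a ^+ 2 + 2 * a * b) + a ^+ 2 * b * \sum_i (x i)^-1).
    have -> : N * (a ^+ 2 + 2 * a * b) = \sum_(i < n) (a ^+ 2 + 2 * a * b).
      by rewrite sumr_const card_ord mulr_natl.
    rewrite !mulr_sumr -!sumrN -!big_split /=; apply: eq_bigr => i _.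
    by field; rewrite gt_eqF.
  by rewrite S1 S2; ring.
by move: h; rewrite E mulrCA pmulr_rge0.
Qed.

End Sums.

(** * Strict inequalities between the means of positive numbers *)

Section Means.
Variables (R : realType) (n : nat).
Hypothesis n3 : (3 <= n)%N.
Implicit Type x : 'I_n -> R.
Local Notation N := (n%:R : R).
Local Notation r := (Num.sqrt n%:R : R).
Local Notation p := (Num.sqrt (n%:R - 1) : R).
Local Notation A := arithmetic_mean.
Local Notation Q := quadratic_mean.
Local Notation H := harmonic_mean.
Local Notation nonconstant x := (~~ [forall i, forall j, x i == x j]).

Fact n_ge2 : (2 <= n)%N. Proof. exact: ltnW n3. Qed.
Fact N_ge3 : 3 <= N. Proof. by rewrite ler_nat. Qed.
Fact root_gt0 : 0 < r. Proof. by have N3 := N_ge3; rewrite sqrtr_gt0; lra. Qed.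
Fact root_pred_gt0 : 0 < p. Proof. by have N3 := N_ge3; rewrite sqrtr_gt0; lra. Qed.
Fact sqr_root : r ^+ 2 = N. Proof. by have N3 := N_ge3; rewrite sqr_sqrtr //; lra. Qed.
Fact sqr_root_pred : p ^+ 2 = N - 1.
Proof. by have N3 := N_ge3; rewrite sqr_sqrtr //; lra. Qed.
Fact root_pred_lt_root : p < r.
Proof. by have N3 := N_ge3; rewrite ltr_sqrt; lra. Qed.

Lemma sum_arithmetic_mean x : \sum_i x i = N * A x.
Proof. by have N3 := N_ge3; rewrite /arithmetic_mean mulrA mulfV ?mul1r //; lra. Qed.

Lemma sum_sqr_ge0 x : 0 <= \sum_i x i ^+ 2.
Proof. by apply: sumr_ge0 => i _; exact: sqr_ge0. Qed.

Lemma sqrt_sum_sqr x : Num.sqrt (\sum_i x i ^+ 2) = r * Q x.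
Proof.
rewrite /quadratic_mean sqrtrM ?invr_ge0 ?ler0n // sqrtrV ?ler0n //.
by rewrite mulrA mulfV ?mul1r // gt_eqF // root_gt0.
Qed.

Lemma sqr_quadratic_mean x : N * Q x ^+ 2 = \sum_i x i ^+ 2.
Proof. by rewrite -sqr_root -exprMn -sqrt_sum_sqr sqr_sqrtr // sum_sqr_ge0. Qed.

Lemma quadratic_mean_ge0 x : 0 <= Q x.
Proof. exact: sqrtr_ge0. Qed.

Lemma arithmetic_lt_quadratic x : nonconstant x -> A x < Q x.
Proof.
have N3 := N_ge3.
move=> nc; have := spread_gt0 (sum_arithmetic_mean x) nc.
rewrite -sqr_quadratic_mean ltr_pM2l; last by lra.
case: (ltP (A x) 0) => [A0 _|A0]; first exact: lt_le_trans A0 (quadratic_mean_ge0 x).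
by rewrite ltr_pXn2r ?nnegrE // quadratic_mean_ge0.
Qed.

(** The normalisation of d is chosen so that the vectors with n - 1 entries A - d and
    one entry A + (n - 1) d, or n - 1 entries A + d and one entry A - (n - 1) d,
    have the same sum and the same sum of squares as x. *)
Lemma standard_deviation x : nonconstant x -> exists2 d : R, 0 < d &
  \sum_i x i ^+ 2 = N * A x ^+ 2 + N * (N - 1) * d ^+ 2.
Proof.
have N3 := N_ge3.
move=> nc; have := spread_gt0 (sum_arithmetic_mean x) nc.
rewrite -subr_gt0 => V0.
have c0 : 0 < N * (N - 1) by rewrite mulr_gt0; lra.
exists (Num.sqrt ((\sum_i x i ^+ 2 - N * A x ^+ 2) / (N * (N - 1)))).
  by rewrite sqrtr_gt0 divr_gt0.
by rewrite sqr_sqrtr ?divr_ge0 ?ltW // [X in _ + X]mulrC divfK ?gt_eqF //; ring.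
Qed.

Lemma inv_sum_gt0 x : (forall i, 0 < x i) -> 0 < \sum_i (x i)^-1.
Proof.
move=> x0; rewrite (bigD1 (Ordinal (ltnW n_ge2))) //=.
by rewrite ltr_wpDr ?invr_gt0 // sumr_ge0 // => i _; rewrite invr_ge0 ltW.
Qed.

Lemma harmonic_mean_pos x : (forall i, 0 < x i) -> H x = N / \sum_i (x i)^-1.
Proof.
move=> x0; rewrite /harmonic_mean ifF //; apply/negbTE/existsPn => i.
by rewrite gt_eqF.
Qed.

Lemma sqr_sum_sub_sum_sqr x : (\sum_i x i) ^+ 2 - \sum_i x i ^+ 2 =
  \sum_i x i * (\sum_k x k - x i).
Proof.
rewrite expr2 mulr_suml -sumrB; apply: eq_bigr => i _; ring.
Qed.

Lemma entry_le_sum x i : (forall i, 0 <= x i) -> x i <= \sum_k x k.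
Proof. by move=> x0; rewrite (bigD1 i) //= lerDl sumr_ge0. Qed.

Lemma sum_sqr_le_sqr_sum x : (forall i, 0 <= x i) ->
  \sum_i x i ^+ 2 <= (\sum_i x i) ^+ 2
    ?= iff [forall i, (x i == 0) || (x i == \sum_k x k)].
Proof.
move=> x0; have t0 i : 0 <= x i * (\sum_k x k - x i).
  by rewrite mulr_ge0 // subr_ge0 entry_le_sum.
split; first by rewrite -subr_ge0 sqr_sum_sub_sum_sqr sumr_ge0.
rewrite eq_sym -subr_eq0 sqr_sum_sub_sum_sqr psumr_eq0 //.
apply/allP/forallP => h i.
  have := h i (mem_index_enum i).
  by rewrite mulf_eq0 subr_eq0 [_ == x i]eq_sym.
by move=> _ /=; rewrite mulf_eq0 subr_eq0 [_ == x i]eq_sym h.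
Qed.

Lemma lower_bound_positive x : (forall i, 0 < x i) -> nonconstant x ->
  (r - 1) * H x < r * A x - Q x.
Proof.
have N3 := N_ge3; have r0 := root_gt0; have p0 := root_pred_gt0.
move=> x0 nc; have [d d0 dE] := standard_deviation nc.
have T0 := inv_sum_gt0 x0.
have A0 : 0 < A x.
  rewrite -(@pmulr_rgt0 _ N) -?sum_arithmetic_mean; last by lra.
  rewrite (bigD1 (Ordinal (ltnW n_ge2))) //= ltr_wpDr ?x0 // sumr_ge0 // => i _.
  exact: ltW.
pose a := A x - d; pose b := A x + (N - 1) * d.
have S1 : \sum_i x i = (N - 1) * a + b.
  by rewrite sum_arithmetic_mean /a /b; ring.
have S2 : \sum_i x i ^+ 2 = (N - 1) * a ^+ 2 + b ^+ 2.
  by rewrite dE /a /b; ring.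
have ab : a < b.
  by rewrite -subr_gt0 (_ : b - a = N * d) ?mulr_gt0 //; [lra | rewrite /a /b; ring].
have b0 : 0 < b by rewrite addr_gt0 // mulr_gt0 //; lra.
(* If a were nonpositive, the sum of the squares would be at least the square of
   the sum, which is impossible for two or more positive numbers. *)
have a0 : 0 < a.
  have h : \sum_i x i ^+ 2 < (\sum_i x i) ^+ 2.
    rewrite (lt_leif (sum_sqr_le_sqr_sum (fun i => ltW (x0 i)))).
    apply/negP => /forallP xS.
    have xE i : x i = \sum_k x k.
      by have /orP[|/eqP//] := xS i; rewrite gt_eqF.
    have : \sum_k x k = N * \sum_k x k.
      rewrite {1}(eq_bigr _ (fun i _ => xE i)) sumr_const card_ord mulr_natl //.
    have NA0 : 0 < (N - 1) * (N * A x).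
      by apply: mulr_gt0; [lra | apply: mulr_gt0 => //; lra].
    by rewrite sum_arithmetic_mean; lra.
  have h2 : 0 < (N - 1) * a * ((N - 2) * a + 2 * b).
    by move: h; rewrite S1 S2 -subr_gt0; congr (_ < _); ring.
  have h3 : 0 < (N - 2) * a + 2 * b.
    have : 0 < N * A x by rewrite mulr_gt0 //; lra.
    by rewrite -sum_arithmetic_mean S1; lra.
  by move: h2; rewrite pmulr_lgt0 // pmulr_rgt0 //; lra.
have := inv_sum_compare n_ge2 x0 a0 S1 S2.
rewrite pmulr_rge0 ?subr_gt0 // subr_ge0 => h.
have D0 : 0 < (N - 1) * b + a by rewrite addr_gt0 // mulr_gt0 //; lra.
have Hle : H x <= N * (a * b) / ((N - 1) * b + a).
  rewrite harmonic_mean_pos // ler_pdivlMr // mulrAC ler_pdivrMr // -mulrA.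
  by rewrite ler_pM2l //; lra.
have := @two_value_lower R r a b; rewrite sqr_root -S1 -S2 => /(_ N3 root_gt0 a0 ab).
rewrite sum_arithmetic_mean sqrt_sum_sqr.
rewrite [X in X < _](_ : _ = r * ((r - 1) *
  (N * (a * b) / ((N - 1) * b + a)))); last by ring: sqr_root.
rewrite [X in _ < X](_ : _ = r * (r * A x - Q x)); last by ring: sqr_root.
rewrite ltr_pM2l // => hlt; apply: le_lt_trans hlt; rewrite ler_wpM2l //.
by rewrite subr_ge0 -(@ler_pXn2r _ 2) ?nnegrE ?(ltW root_gt0) // sqr_root; lra.
Qed.

Lemma upper_bound_positive x : (forall i, 0 < x i) -> nonconstant x ->
  r * A x - p * Q x < (r - p) * H x.
Proof.
have N3 := N_ge3; have r0 := root_gt0; have p0 := root_pred_gt0.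
move=> x0 nc; have [d d0 dE] := standard_deviation nc.
have T0 := inv_sum_gt0 x0.
pose a := A x + d; pose b := A x - (N - 1) * d.
have S1 : \sum_i x i = (N - 1) * a + b.
  by rewrite sum_arithmetic_mean /a /b; ring.
have S2 : \sum_i x i ^+ 2 = (N - 1) * a ^+ 2 + b ^+ 2.
  by rewrite dE /a /b; ring.
have ba : b < a.
  by rewrite -subr_gt0 (_ : a - b = N * d) ?mulr_gt0 //; [lra | rewrite /a /b; ring].
have A0 : 0 <= A x.
  rewrite -(@pmulr_rge0 _ N) -?sum_arithmetic_mean; last by lra.
  by rewrite sumr_ge0 // => i _; exact: ltW.
have [b0|b0] := ltP 0 b.
  have a0 := lt_trans b0 ba.
  have := inv_sum_compare n_ge2 x0 a0 S1 S2.
  rewrite nmulr_rge0 ?subr_lt0 // subr_le0 => h.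
  have D0 : 0 < (N - 1) * b + a by rewrite addr_gt0 // mulr_gt0 //; lra.
  have Hge : N * (a * b) / ((N - 1) * b + a) <= H x.
    rewrite harmonic_mean_pos // ler_pdivrMr // mulrAC ler_pdivlMr // -mulrA.
    by rewrite ler_pM2l //; lra.
  have := @two_value_upper R r p a b; rewrite sqr_root -S1 -S2.
  move=> /(_ N3 root_gt0 root_pred_gt0 sqr_root_pred b0 ba).
  rewrite sum_arithmetic_mean sqrt_sum_sqr.
  rewrite [X in X < _](_ : _ = r * (r * A x - p * Q x)); last by ring: sqr_root.
  rewrite [X in _ < X](_ : _ = r * ((r - p) *
    (N * (a * b) / ((N - 1) * b + a)))); last by ring: sqr_root.
  rewrite ltr_pM2l // => /lt_le_trans; apply.
  by rewrite ler_wpM2l // subr_ge0 ltW // root_pred_lt_root.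
(* Here b <= 0: the deviation is large enough for r A <= p Q. *)
apply: (@le_lt_trans _ _ 0); last first.
  by rewrite mulr_gt0 ?subr_gt0 ?root_pred_lt_root // harmonic_mean_pos //
    divr_gt0 //; lra.
have rA0 := mulr_ge0 (ltW r0) A0.
have pQ0 := mulr_ge0 (ltW p0) (quadratic_mean_ge0 x).
rewrite subr_le0 -(@ler_pXn2r _ 2) ?nnegrE //.
rewrite [(r * _) ^+ 2]exprMn [(p * _) ^+ 2]exprMn sqr_root sqr_root_pred.
rewrite -(@ler_pM2l _ N); last by lra.
rewrite [leRHS]mulrCA sqr_quadratic_mean dE.
have Ad : A x ^+ 2 <= ((N - 1) * d) ^+ 2.
  have md0 : 0 <= (N - 1) * d by apply: mulr_ge0; lra.
  by rewrite ler_pXn2r ?nnegrE // -subr_le0.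
have : N * A x ^+ 2 <= N * ((N - 1) * d) ^+ 2 by rewrite ler_pM2l //; lra.
lra.
Qed.

(** For positive entries H < A need not be proved separately: it follows from
    [lower_bound_positive], as (r - 1) H < r A - Q < (r - 1) Q when A < Q. *)
Lemma harmonic_lt_quadratic x : (forall i, 0 <= x i) -> nonconstant x ->
  H x < Q x.
Proof.
have N3 := N_ge3; have r0 := root_gt0; have p0 := root_pred_gt0.
move=> x0 nc; have AQ := arithmetic_lt_quadratic nc.
have [/existsP z|/existsPn z] := boolP [exists i, x i == 0].
  rewrite /harmonic_mean ifT; last exact/existsP.
  apply: le_lt_trans AQ; rewrite mulr_ge0 ?invr_ge0 ?ler0n //.
  by rewrite sumr_ge0.
have xp i : 0 < x i by rewrite lt0r z x0.
have r1 : 0 < r - 1.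
  by rewrite subr_gt0 -(@ltr_pXn2r _ 2) ?nnegrE ?(ltW root_gt0) // sqr_root; lra.
have : (r - 1) * H x < (r - 1) * Q x.
  apply: lt_trans (lower_bound_positive xp nc) _; rewrite mulrBl mul1r ltrD2r.
  by rewrite ltr_pM2l.
by rewrite ltr_pM2l.
Qed.

(** * Vectors with a zero entry *)

Lemma leif_lower_bound_zero x : (forall i, 0 <= x i) ->
  Q x <= r * A x ?= iff [forall i, (x i == 0) || (x i == \sum_k x k)].
Proof.
move=> x0; have N3 := N_ge3; have r0 := root_gt0; have p0 := root_pred_gt0.
have A0 : 0 <= r * A x.
  by rewrite !mulr_ge0 ?invr_ge0 ?ler0n ?sumr_ge0 // ltW.
have [h1 h2] := sum_sqr_le_sqr_sum x0.
have SE : (\sum_i x i) ^+ 2 = N * (r * A x) ^+ 2.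
  by rewrite sum_arithmetic_mean; ring: sqr_root.
rewrite SE -sqr_quadratic_mean in h1 h2.
split.
  by rewrite -(@ler_pXn2r _ 2) ?nnegrE ?quadratic_mean_ge0 // -(@ler_pM2l _ N) //; lra.
rewrite -h2 (inj_eq (mulfI _)); last by rewrite gt_eqF //; lra.
by rewrite eqrXn2 // quadratic_mean_ge0.
Qed.

Lemma leif_upper_bound_zero x (j : 'I_n) : (forall i, 0 <= x i) -> x j = 0 ->
  r * A x <= p * Q x ?= iff [forall (i | i != j), x i == (\sum_k x k) / (N - 1)].
Proof.
move=> x0 xj; have N3 := N_ge3; have r0 := root_gt0; have p0 := root_pred_gt0.
have A0 : 0 <= r * A x.
  by rewrite !mulr_ge0 ?invr_ge0 ?ler0n ?sumr_ge0 // ltW.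
have Q0 : 0 <= p * Q x by rewrite mulr_ge0 ?quadratic_mean_ge0 // ltW.
have := spread_others n_ge2 x j; rewrite xj !subr0 expr0n /= subr0.
have -> : (N - 1) * \sum_i x i ^+ 2 - (\sum_i x i) ^+ 2 =
  N * ((p * Q x) ^+ 2 - (r * A x) ^+ 2).
  by rewrite -sqr_quadratic_mean sum_arithmetic_mean; ring: sqr_root sqr_root_pred.
move=> E.
have t0 i : i != j -> 0 <= (x i - (\sum_k x k) / (N - 1)) ^+ 2.
  by rewrite sqr_ge0.
split.
  rewrite -(@ler_pXn2r _ 2) ?nnegrE // -subr_ge0 -(@pmulr_rge0 _ N); last by lra.
  by rewrite E mulr_ge0 ?sumr_ge0 //; lra.
rewrite -(@eqrXn2 _ 2) // eq_sym -subr_eq0.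
have -> : ((p * Q x) ^+ 2 - (r * A x) ^+ 2 == 0) =
  (\sum_(i | i != j) (x i - (\sum_k x k) / (N - 1)) ^+ 2 == 0).
  apply/eqP/eqP => h; move: E; rewrite h mulr0 => /eqP.
    by rewrite eq_sym mulf_eq0 gt_eqF /=; [move/eqP | lra].
  by rewrite mulf_eq0 gt_eqF /=; [move/eqP | lra].
rewrite psumr_eq0 //; apply/allP/forall_inP => h i.
  by move=> ij; have := h i (mem_index_enum i); rewrite ij sqrf_eq0 subr_eq0.
by move=> _; apply/implyP => ij; rewrite sqrf_eq0 subr_eq0 h.
Qed.

Lemma harmonic_mean_zero x (j : 'I_n) : x j = 0 -> H x = 0.
Proof.
by move=> xj; rewrite /harmonic_mean ifT //; apply/existsP; exists j; rewrite xj.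
Qed.

(** * Bounds on the ratio and their equality cases *)

Lemma mean_ratio_nonconstant x : nonconstant x ->
  mean_ratio x = (A x - H x) / (Q x - H x).
Proof. by move=> /negbTE nc; rewrite /mean_ratio nc. Qed.

Lemma exists_other (j : 'I_n) : exists i, i != j.
Proof.
have : (0 < #|[pred i | i != j]|)%N by rewrite cardC1 card_ord -subn1 subn_gt0 n_ge2.
by case/card_gt0P => i ij; exists i.
Qed.

Lemma one_nonzeroP x : mean_domain x ->
  reflect (exists j, x j != 0 /\ forall i, i != j -> x i = 0)
          [forall i, (x i == 0) || (x i == \sum_k x k)].
Proof.
move=> xD; apply: (iffP forallP) => [h|[k [xk hk]] i].
  have [x0 [j xj]] := xD.
  exists j; split=> //; have := h j; rewrite (negPf xj) => /eqP.
  rewrite (bigD1 j) //= => S1.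
  have /psumr_eq0P : \sum_(i | i != j) x i = 0 by lra.
  by apply => i _; exact: x0.
have [->|/hk ->] := eqVneq i k; last by rewrite eqxx.
by rewrite (bigD1 k) //= big1 ?addr0 ?eqxx ?orbT.
Qed.

Lemma one_nonzero_nonconstant x :
  (exists j, x j != 0 /\ forall i, i != j -> x i = 0) ->
  nonconstant x /\ exists k, x k = 0.
Proof.
case=> j [xj hj]; have [i ij] := exists_other j.
split; last by exists i; exact: hj.
by apply/forallP => /(_ j) /forallP /(_ i); rewrite (hj i ij) (negPf xj).
Qed.

Lemma one_zero_nonconstant x :
  (exists j, x j = 0 /\ exists c, c != 0 /\ forall i, i != j -> x i = c) ->
  nonconstant x.
Proof.
case=> j [xj [c [c0 hc]]]; have [i ij] := exists_other j.
by apply/forallP => /(_ i) /forallP /(_ j); rewrite (hc i ij) xj (negPf c0).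
Qed.

Lemma mean_ratio_lower x : mean_domain x ->
  1 / r <= mean_ratio x /\
  (mean_ratio x = 1 / r <-> exists j, x j != 0 /\ forall i, i != j -> x i = 0).
Proof.
move=> xD; have [x0 _] := xD; have N3 := N_ge3.
have r0 := root_gt0; have p0 := root_pred_gt0.
have [c|nc] := boolP [forall i, forall j, x i == x j].
  have rlt : 1 / r < 2 / 3.
    by rewrite ltr_pdivrMr // -(@ltr_pM2l _ 3) //; have := sqr_root; nra.
  rewrite /mean_ratio c; split; first exact: ltW.
  split=> [h|/one_nonzero_nonconstant []]; last by rewrite c.
  by move: rlt; rewrite -h ltxx.
have QH : 0 < Q x - H x by rewrite subr_gt0 harmonic_lt_quadratic.
rewrite mean_ratio_nonconstant //.
have cmpG (u v : R) : 0 < v ->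
    ((1 / r <= u / v) = (v <= r * u)) * ((u / v == 1 / r) = (v == r * u)).
  move=> v0; split; last by rewrite eqr_div ?lt0r_neq0 // mul1r eq_sym [r * _]mulrC.
  by rewrite ler_pdivlMr // mulrAC mul1r ler_pdivrMr // [r * _]mulrC.
have [cmp cmpE] := cmpG (A x - H x) _ QH.
have [/existsP [j /eqP xj]|/existsPn z] := boolP [exists i, x i == 0].
  have [h1 h2] := leif_lower_bound_zero x0.
  rewrite cmp (harmonic_mean_zero xj) !subr0 in cmpE *; split=> //.
  rewrite h2 in cmpE; split=> [/eqP|]; first by rewrite cmpE => /one_nonzeroP; apply.
  by move=> /(one_nonzeroP xD) h; apply/eqP; rewrite cmpE.
have xp i : 0 < x i by rewrite lt0r z x0.
have lt : Q x - H x < r * (A x - H x) by have := lower_bound_positive xp nc; lra.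
rewrite cmp ltW //; split=> //; split=> [/eqP|].
  by rewrite cmpE lt_eqF.
by case/one_nonzero_nonconstant => _ [k xk]; have := z k; rewrite xk eqxx.
Qed.

Lemma mean_ratio_upper x : mean_domain x ->
  mean_ratio x <= p / r /\
  (mean_ratio x = p / r <->
   exists j, x j = 0 /\ exists c, c != 0 /\ forall i, i != j -> x i = c).
Proof.
move=> xD; have [x0 [k xk]] := xD; have N3 := N_ge3.
have r0 := root_gt0; have p0 := root_pred_gt0.
have [c|nc] := boolP [forall i, forall j, x i == x j].
  have rlt : 2 / 3 < p / r.
    have r23 : 0 <= 2 / 3 * r by apply: mulr_ge0; lra.
    rewrite ltr_pdivlMr // -(@ltr_pXn2r _ 2) ?nnegrE ?(ltW p0) //.
    by rewrite exprMn sqr_root sqr_root_pred; lra.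
  rewrite /mean_ratio c; split; first exact: ltW.
  split=> [h|/one_zero_nonconstant]; last by rewrite c.
  by move: rlt; rewrite -h ltxx.
have QH : 0 < Q x - H x by rewrite subr_gt0 harmonic_lt_quadratic.
rewrite mean_ratio_nonconstant //.
have cmpG (u v : R) : 0 < v ->
    ((u / v <= p / r) = (r * u <= p * v)) * ((u / v == p / r) = (r * u == p * v)).
  move=> v0; split; last by rewrite eqr_div ?lt0r_neq0 // [r * _]mulrC.
  by rewrite ler_pdivrMr // mulrAC ler_pdivlMr // [r * _]mulrC.
have [cmp cmpE] := cmpG (A x - H x) _ QH.
have [/existsP [j /eqP xj]|/existsPn z] := boolP [exists i, x i == 0].
  have h1 := (leif_upper_bound_zero x0 xj).1.
  rewrite cmp (harmonic_mean_zero xj) !subr0 in cmpE *; split=> //.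
  split=> [/eqP|[l [xl [c [c0 hc]]]]].
    rewrite cmpE (leif_upper_bound_zero x0 xj) => /forall_inP h; exists j; split=> //.
    exists (x k); split=> // i ij.
    have kj : k != j by apply: contraNneq xk => ->; rewrite xj.
    by rewrite (eqP (h i ij)) (eqP (h k kj)).
  apply/eqP; rewrite cmpE (leif_upper_bound_zero x0 xl).
  apply/forall_inP => i il; rewrite hc // (bigD1 l) //= xl add0r.
  rewrite (eq_bigr _ hc) (sumr_const [pred i | i != l]) -[c *+ _]mulr_natr.
  rewrite (card_others R n_ge2).
  by rewrite mulfK // gt_eqF //; lra.
have xp i : 0 < x i by rewrite lt0r z x0.
have lt : r * (A x - H x) < p * (Q x - H x) by have := upper_bound_positive xp nc; lra.
rewrite cmp ltW //; split=> //; split=> [/eqP|].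
  by rewrite cmpE lt_eqF.
by case=> j [xj _]; have := z j; rewrite xj eqxx.
Qed.

End Means.

Theorem theorem1p1 (R : realType) (n : nat) (hn : (3 <= n)%N) (C1 C2 : R) :
  [/\ (forall x : 'I_n -> R, mean_domain x -> C1 <= mean_ratio x <= C2)
        <-> (C1 <= 1 / Num.sqrt n%:R /\ C2 >= Num.sqrt ((n%:R - 1) / n%:R)),
      (forall x : 'I_n -> R, mean_domain x -> C1 <= mean_ratio x) ->
        forall x : 'I_n -> R, mean_domain x ->
          (C1 = mean_ratio x <->
           C1 = 1 / Num.sqrt n%:R /\
           exists j, x j != 0 /\ forall i, i != j -> x i = 0)
    & (forall x : 'I_n -> R, mean_domain x -> mean_ratio x <= C2) ->
        forall x : 'I_n -> R, mean_domain x ->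
          (mean_ratio x = C2 <->
           C2 = Num.sqrt ((n%:R - 1) / n%:R) /\
           exists j, x j = 0 /\
             exists c, c != 0 /\ forall i, i != j -> x i = c)].
Proof.
have N1 : 1 <= n%:R :> R by rewrite ler1n (ltnW (ltnW hn)).
rewrite sqrtrM ?subr_ge0 // sqrtrV ?ler0n //.
pose j0 : 'I_n := Ordinal (ltnW (ltnW hn)).
pose e : 'I_n -> R := fun i => (i == j0)%:R.
pose f : 'I_n -> R := fun i => (i != j0)%:R.
have eD : mean_domain e.
  by split=> [i|]; [exact: ler0n | exists j0; rewrite /e eqxx oner_neq0].
have fD : mean_domain f.
  split=> [i|]; first exact: ler0n.
  by have [i ij] := exists_other hn j0; exists i; rewrite /f ij oner_neq0.
have eE : mean_ratio e = 1 / Num.sqrt n%:R.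
  apply/(mean_ratio_lower hn eD).2; exists j0.
  by rewrite /e eqxx oner_neq0; split=> // i /negbTE ->.
have fE : mean_ratio f = Num.sqrt (n%:R - 1) / Num.sqrt n%:R.
  apply/(mean_ratio_upper hn fD).2; exists j0; rewrite /f eqxx; split=> //.
  by exists 1; rewrite oner_neq0; split=> // i ->.
split.
- split=> [h|[h1 h2] x xD].
    rewrite -eE -fE; have /andP[-> _] := h e eD; have /andP[_ ->] := h f fD.
    by [].
  apply/andP; split.
    exact: le_trans h1 (mean_ratio_lower hn xD).1.
  exact: le_trans (mean_ratio_upper hn xD).1 h2.
- move=> h x xD; have [lo loE] := mean_ratio_lower hn xD.
  split=> [CE|[-> /loE //]].
  have xE : mean_ratio x = 1 / Num.sqrt n%:R.
    by apply/le_anti; rewrite lo andbT -CE -eE h.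
  by split; [rewrite CE | apply/loE].
- move=> h x xD; have [up upE] := mean_ratio_upper hn xD.
  split=> [CE|[-> /upE //]].
  have xE : mean_ratio x = Num.sqrt (n%:R - 1) / Num.sqrt n%:R.
    by apply/le_anti; rewrite up /= CE -fE h.
  by split; [rewrite -CE | apply/upE].
Qed.
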